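(* Let $n$ be a positive integer. Let $L_n$ be the number of equivalence classes of signatures of length $n$ with respect to the rotations $O_k$, $k\in\mathbb{Z}$, and let $K_n$ be the number of equivalence classes of signatures of length $n$ with respect to the transformations $O_k$, $k\in\mathbb{Z}$, and $T$. 1) If $n$ is odd, then $K_n=\dfrac{L_n}{2}$. 2) If $n$ is even, then $K_n=\dfrac{L_n+I_n}{2}$, where $I_n$ is the number of equivalence classes (with respect to the transformations $O_k$) of signatures of length $n$ having the same number of $+$ and $-$ which are invariant under the map $T$. Moreover, if $n=2k$, then $I_n=2^{k-1}$.
   Context: A signature of length $n$ is a tuple $\sigma=(\sigma_0,\sigma_1,\dots,\sigma_{n-1})$ with each $\sigma_l\in\{1,-1\}$ (written $+$, $-$). For $k\in\mathbb{Z}$ the rotation $O_k$ acts on signatures of length $n$ by $O_k(\sigma)=\tilde\sigma$, $\tilde\sigma_l=\sigma_{(n-k+l)\bmod n}$, $l=0,\dots,n-1$. The reflection $T$ acts by $T(\sigma)=(-\sigma_{n-1},-\sigma_{n-2},\dots,-\sigma_0)$. Since $O_kT=TO_{-k}$, $T$ maps rotation classes to rotation classes; a rotation class is invariant under $T$ if $T$ maps it to itself. Two signatures are equivalent with respect to a set of transformations if one is obtained from the other by a composition of them. *)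

(* Defs.v *)
From mathcomp Require Import all_boot all_order all_algebra.
From mathcomp Require Import boolp.

Set Implicit Arguments.
Unset Strict Implicit.
Unset Printing Implicit Defensive.

Import Order.TTheory GRing.Theory Num.Theory.

Local Open Scope ring_scope.

(* The sign 1 (written +) is encoded as [true] and the sign -1 (written -) as
   [false], so that [~~] is the change of sign. *)
Definition signature (n : nat) := {ffun 'I_n -> bool}.

Lemma rot_index_subproof (n : nat) (k : int) (l : 'I_n) :
  (absz ((n%:Z - k + l%:Z) %% n%:Z)%Z < n)%N.
Proof.
have n_gt0 : (0 < n)%N by exact: leq_ltn_trans (leq0n l) (ltn_ord l).
have n_neq0 : n%:Z != 0 by rewrite eqz_nat -lt0n.
by rewrite -ltz_nat gez0_abs ?modz_ge0// ltz_pmod.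
Qed.

(* [(_ %% n)%Z] is the representative in [0, n), so [absz] only casts. *)
Definition rot_index (n : nat) (k : int) (l : 'I_n) : 'I_n :=
  Ordinal (rot_index_subproof k l).

Definition rotate (n : nat) (k : int) (s : signature n) : signature n :=
  [ffun l => s (rot_index k l)].

(* [rev_ord l] has value n - 1 - l. *)
Definition reflection (n : nat) (s : signature n) : signature n :=
  [ffun l => ~~ s (rev_ord l)].

Definition rotations (n : nat) (f : signature n -> signature n) : Prop :=
  exists k : int, f = @rotate n k.

Definition rotations_and_reflection (n : nat)
    (f : signature n -> signature n) : Prop :=
  rotations f \/ f = @reflection n.

(* [t] is obtained from [s] by a (possibly empty) composition of elements of
   [F]. This is an equivalence relation for the two sets [F] above, because
   [O_(-k)] inverts [O_k] and [T] is an involution. *)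
Definition equivalent (n : nat) (F : (signature n -> signature n) -> Prop) :
    rel (signature n) :=
  connect (fun s t => `[< exists2 f, F f & t = f s >]).

Definition eq_classes (n : nat) (F : (signature n -> signature n) -> Prop) :
    {set {set signature n}} :=
  equivalence_partition (equivalent F) [set: signature n].

Definition balanced (n : nat) : {set signature n} :=
  [set s : signature n | #|[set l | s l]| == #|[set l | ~~ s l]|].

Definition num_L (n : nat) : nat := #|eq_classes (@rotations n)|.

Definition num_K (n : nat) : nat := #|eq_classes (@rotations_and_reflection n)|.

Definition num_I (n : nat) : nat :=
  #|[set C in eq_classes (@rotations n) |
      (C \subset balanced n) && ([set reflection s | s in C] == C)]|.

(* Main.v *)
(* The reflection T induces an involution on rotation classes whose orbits are
   the classes counted by K_n, so 2 K_n = L_n + J_n with J_n the number of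
   T-invariant rotation classes; an invariant class is balanced because T
   exchanges the numbers of + and -. By orbit-stabilizer, each invariant class C
   contributes exactly n pairs (s, a) with s in C and s = O_(-a) T s, so n J_n counts
   all such pairs. For fixed a they are the s with s (c - l) = - s l, where
   c = n - 1 - a: there is none if l |-> c - l has a fixed point mod n, which
   happens unless n is even and c odd, and otherwise there are 2^(n/2). *)
Require Import Defs.
From mathcomp Require Import all_boot all_order all_algebra all_fingroup.
From mathcomp Require Import boolp zify.
Set Implicit Arguments.
Unset Strict Implicit.
Unset Printing Implicit Defensive.
Import Order.TTheory GRing.Theory Num.Theory.
Local Open Scope ring_scope.

(** * Counting with an involution *)

(* A function reversed by j is determined by its values on a set
   containing exactly one point of each orbit of j. *)
Lemma card_anti_invariant (T : finType) (j : T -> T) :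
  involutive j -> (forall x, j x != x) ->
  #|[set s : {ffun T -> bool} | [forall x, s (j x) == ~~ s x]]| = (2 ^ #|T|./2)%N.
Proof.
(* [A] takes from each pair [x], [j x] the element of smaller rank, so [j] swaps [A] with its
   complement. *)
move=> jK j_neq; pose A := [set x | enum_rank x < enum_rank (j x)]%N.
have memj x : (j x \in A) = (x \notin A).
  rewrite !inE jK -leqNgt ltn_neqAle; case: eqP => //= /val_inj /enum_rank_inj e.
  by have := j_neq x; rewrite e eqxx.
have cardA : #|T|./2 = #|A|.
  have jA : #|~: A| = #|A|.
    rewrite -(card_imset (mem A) (can_inj jK)); apply: eq_card => x.
    rewrite inE; apply/idP/imsetP => [xA|[y yA ->]]; last by rewrite memj negbK.
    by exists (j x); rewrite ?memj ?jK.
  by rewrite -(cardsC A) jA addnn doubleK.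
rewrite cardA -card_powerset.
rewrite -[LHS](@card_in_imset _ _ (fun s : {ffun T -> bool} => [set x in A | s x])).
  apply: eq_card => B; rewrite powersetE; apply/imsetP/subsetP => [[s _ ->] x|BA].
    by rewrite inE => /andP[].
  (* The values on [A] are prescribed by [B]; those off [A] are then forced by the reversal. *)
  exists [ffun x => if x \in A then x \in B else j x \notin B].
    rewrite inE; apply/forallP => x; rewrite !ffunE memj jK.
    by case: (x \in A); rewrite ?negbK.
  apply/setP => x; rewrite inE ffunE; case: ifP => //= /negP xA.
  by apply/negP => /BA.
move=> s t /[!inE] /forallP hs /forallP ht /setP e; apply/ffunP.
have eA x : x \in A -> s x = t x by move=> xA; have := e x; rewrite [LHS]inE [RHS]inE xA.
move=> x; have [/eA //|xA] := boolP (x \in A).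
apply: negb_inj; rewrite -(eqP (hs x)) -(eqP (ht x)); apply: eA.
by rewrite memj.
Qed.

(** Each fibre of [g] in [P] is a pair [x], [f x]. Giving [x] weight 2 if [f] fixes it and 1
    otherwise makes every fibre weigh 2. *)
Lemma card_imset_involution (T U : finType) (P : {set T}) (f : T -> T) (g : T -> U) :
  {in P, forall x, f x \in P} ->
  {in P &, forall x y, (g x == g y) = (x == y) || (x == f y)} ->
  (2 * #|g @: P| = #|P| + #|[set x in P | f x == x]|)%N.
Proof.
move=> fP gE.
have -> : (#|P| + #|[set x in P | f x == x]| = \sum_(x in P) (1 + (f x == x)))%N.
  by rewrite big_split /= sum1_card -sum1dep_card big_mkcondr.
rewrite (partition_big_imset g) /= mulnC -sum_nat_const.
apply: eq_bigr => _ /imsetP[x xP ->].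
rewrite (eq_bigl (mem [set x; f x])); last first.
  move=> y; rewrite !inE; have [yP|yP] /= := boolP (y \in P); first by rewrite gE.
  by symmetry; apply/negbTE; apply: contra yP => /orP[] /eqP->; rewrite ?fP.
have [e|ne] := eqVneq (f x) x; first by rewrite e setUid big_set1 e eqxx.
(* [gE] at [f x] and [x] gives [g (f x) = g x]; [gE] in the opposite order then leaves only
   [x = f (f x)]. *)
have ffx : f (f x) = x.
  have := gE _ _ (fP _ xP) xP; rewrite eqxx orbT => /eqP/esym/eqP.
  rewrite gE ?fP// => /orP[/eqP e|/eqP //].
  by rewrite -e eqxx in ne.
rewrite big_setU1 ?inE ?[x == f x]eq_sym ?(negbTE ne)//=.
by rewrite big_set1 ffx [x == f x]eq_sym (negbTE ne).
Qed.

(** * Rotations as a group action, and their commutation with T *)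

(** This is O_(-a). Addition in ['I_m.+1] is modulo [m.+1], so rotations become an action of a
    finite group and orbit-stabilizer applies. *)
Definition shift (m : nat) (s : signature m.+1) (a : 'I_m.+1) : signature m.+1 :=
  [ffun l => s (l + a)].

Lemma shift_is_action (m : nat) : is_action [set: 'I_m.+1] (@shift m).
Proof.
apply: is_total_action => [s|s a b]; apply/ffunP => l; rewrite !ffunE ?addr0//.
by rewrite -addrA [b + a]addrC.
Qed.

Canonical shift_action (m : nat) := Action (@shift_is_action m).

(** [rot_index k ord0] is the residue of -k modulo [m.+1]. *)
Lemma rotate_shift (m : nat) (k : int) :
  @rotate m.+1 k = (@shift m)^~ (Defs.rot_index k ord0).
Proof.
apply/funext => s; apply/ffunP => l; rewrite !ffunE; congr (s _); apply/val_inj => /=.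
apply: (can_inj absz_nat); rewrite -modz_nat PoszD !gez0_abs ?modz_ge0//.
by rewrite modzDmr addr0 addrC.
Qed.

Lemma shift_rotate (m : nat) (a : 'I_m.+1) : (@shift m)^~ a = @rotate m.+1 (- a%:Z).
Proof.
rewrite rotate_shift; apply/funext => s; congr (shift s _); apply/val_inj => /=.
by rewrite opprK addr0 modzDl modz_nat absz_nat modn_small.
Qed.

Definition rot_class (m : nat) (s : signature m.+1) : {set signature m.+1} :=
  orbit (shift_action m) [set: 'I_m.+1] s.

Lemma rot_classP (m : nat) (s t : signature m.+1) :
  reflect (exists a, t = shift s a) (t \in rot_class s).
Proof. by apply: (iffP orbitP) => [[a _ <-]|[a ->]]; exists a. Qed.

Lemma rot_class_eq (m : nat) (s t : signature m.+1) :
  (rot_class s == rot_class t) = (s \in rot_class t).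
Proof. by apply/eqP/idP => /orbit_eqP. Qed.

Lemma reflectionK (n : nat) : involutive (@reflection n).
Proof. by move=> s; apply/ffunP => l; rewrite !ffunE rev_ordK negbK. Qed.

Lemma rev_ordE (m : nat) (l : 'I_m.+1) : rev_ord l = ord_max - l.
Proof.
have lm := leq_ord l; apply/val_inj => /=.
rewrite modnDmr (_ : m + (m.+1 - l) = m - l + m.+1)%N; last by lia.
by rewrite modnDr subSS modn_small// ltnS leq_subr.
Qed.

(** T reads the indices backwards, through [ord_max - l], which changes the sign of the
    displacement. *)
Lemma reflection_shift (m : nat) (s : signature m.+1) (a : 'I_m.+1) :
  reflection (shift s a) = shift (reflection s) (- a).
Proof.
apply/ffunP => l; rewrite !ffunE !rev_ordE; congr (~~ s _).
by rewrite opprD opprK addrA.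
Qed.

Lemma imset_reflection (m : nat) (s : signature m.+1) :
  [set reflection t | t in rot_class s] = rot_class (reflection s).
Proof.
apply/setP => t; apply/imsetP/rot_classP => [[_ /rot_classP[a ->] ->]|[a ->]].
  by exists (- a); rewrite reflection_shift.
exists (shift s (- a)); first by apply/rot_classP; exists (- a).
by rewrite reflection_shift opprK.
Qed.

Lemma mem_reflection (m : nat) (s t : signature m.+1) :
  (reflection s \in rot_class t) = (s \in rot_class (reflection t)).
Proof.
rewrite -imset_reflection -{2}[s]reflectionK mem_imset//.
exact: inv_inj (@reflectionK _).
Qed.

(** * Equivalence classes as orbits *)

(** Induction along the connecting path. With [A] a candidate class, this shows that no composition
    leaves it. *)
Lemma sub_equivalent (n : nat) (F : (signature n -> signature n) -> Prop)
    (A : {set signature n}) (s t : signature n) :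
  (forall f u, F f -> u \in A -> f u \in A) ->
  equivalent F s t -> s \in A -> t \in A.
Proof.
move=> FA /connectP[p + ->]; elim: p s => //= u p IH s /andP[/asboolP[f Ff ->] pp] sA.
by apply: IH pp _; exact: FA.
Qed.

Lemma equivalent1 (n : nat) (F : (signature n -> signature n) -> Prop)
  (f : signature n -> signature n) (s : signature n) : F f -> equivalent F s (f s).
Proof. by move=> Ff; apply: connect1; apply/asboolP; exists f. Qed.

Lemma mem_rot_class_shift (m : nat) (s t : signature m.+1) (a : 'I_m.+1) :
  t \in rot_class s -> shift t a \in rot_class s.
Proof. by rewrite -rot_class_eq => /eqP <-; apply/rot_classP; exists a. Qed.

Lemma equivalent_rotations (m : nat) (s t : signature m.+1) :
  equivalent (@rotations m.+1) s t = (t \in rot_class s).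
Proof.
apply/idP/rot_classP => [st|[a ->]].
  apply/rot_classP; apply: sub_equivalent st _; last exact: orbit_refl.
  by move=> _ u [k ->]; rewrite rotate_shift; exact: mem_rot_class_shift.
by apply: (@equivalent1 _ _ ((@shift m)^~ a)); rewrite shift_rotate; exists (- a%:Z).
Qed.

(** The union is stable under rotations, and T swaps its two parts because it maps rotation classes
    to rotation classes. *)
Lemma equivalent_rotations_reflection (m : nat) (s t : signature m.+1) :
  equivalent (@rotations_and_reflection m.+1) s t =
  (t \in rot_class s :|: rot_class (reflection s)).
Proof.
have rot u v : v \in rot_class u -> equivalent (@rotations_and_reflection m.+1) u v.
  move=> /rot_classP[a ->].
  apply: (@equivalent1 _ _ ((@shift m)^~ a)); left; rewrite shift_rotate.
  by exists (- a%:Z).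
apply/idP/setUP => [st|[/rot //|/rot]].
  apply/setUP; apply: sub_equivalent st _; last by rewrite inE orbit_refl.
  move=> _ u [[k ->]|->] /setUP[]uA; apply/setUP.
  - by left; rewrite rotate_shift; exact: mem_rot_class_shift.
  - by right; rewrite rotate_shift; exact: mem_rot_class_shift.
  - by right; rewrite mem_reflection reflectionK.
  - by left; rewrite mem_reflection.
by apply: connect_trans; apply: equivalent1; right.
Qed.

Lemma eq_classes_rotations (m : nat) :
  eq_classes (@rotations m.+1) = [set rot_class s | s in [set: signature m.+1]].
Proof.
apply: eq_imset => s; apply/setP => t.
by rewrite inE in_setT equivalent_rotations.
Qed.

Lemma eq_classes_rotations_reflection (m : nat) :
  eq_classes (@rotations_and_reflection m.+1) =
  [set C :|: [set reflection t | t in C] | C in eq_classes (@rotations m.+1)].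
Proof.
rewrite eq_classes_rotations -imset_comp; apply: eq_imset => s; apply/setP => t /=.
by rewrite inE in_setT equivalent_rotations_reflection imset_reflection.
Qed.

(** * The relation between K, L and the invariant classes *)

Definition invariant_classes (n : nat) : {set {set signature n}} :=
  [set C in eq_classes (@rotations n) | [set reflection s | s in C] == C].

(** [card_imset_involution] is applied to T acting on rotation classes, with [g] sending C to the
    union of C and T(C): two such unions agree exactly when the classes are equal or swapped by
    T. *)
Lemma double_num_K (m : nat) :
  (2 * num_K m.+1 = num_L m.+1 + #|invariant_classes m.+1|)%N.
Proof.
rewrite /num_K eq_classes_rotations_reflection /num_L /invariant_classes.
rewrite eq_classes_rotations.
apply: (@card_imset_involution _ _ [set rot_class s | s in [set: signature m.+1]]
  (fun C => [set reflection t | t in C])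
  (fun C => C :|: [set reflection t | t in C])).
  by move=> _ /imsetP[s _ ->]; rewrite imset_reflection imset_f.
move=> _ _ /imsetP[s _ ->] /imsetP[t _ ->].
rewrite !imset_reflection !rot_class_eq; apply/eqP/orP => [e|].
  have : s \in rot_class s :|: rot_class (reflection s) by rewrite inE orbit_refl.
  by rewrite e => /setUP[]; [left|right].
case=> h; last rewrite setUC; congr (_ :|: _); apply/eqP;
  by rewrite rot_class_eq ?mem_reflection ?reflectionK.
Qed.

(** If T s is [shift s a], then [s (l + a) = ~~ s (rev_ord l)]; both index maps are bijections, so
    the two signs occur equally often. *)
Lemma reflection_orbit_balanced (m : nat) (s : signature m.+1) :
  reflection s \in rot_class s -> s \in balanced m.+1.
Proof.
move=> /rot_classP[a e]; rewrite inE.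
apply/eqP; rewrite -(card_preimset [set l | ~~ s l] (@rev_ord_inj _)).
rewrite -[LHS](card_preimset _ (addIr a)); apply: eq_card => l; rewrite !inE.
by move/ffunP: e => /(_ l); rewrite !ffunE.
Qed.

Lemma num_I_invariant (m : nat) : num_I m.+1 = #|invariant_classes m.+1|.
Proof.
apply: eq_card => C; rewrite !inE; have [|//] := boolP (C \in _).
rewrite eq_classes_rotations => /imsetP[s _ ->] /=.
rewrite imset_reflection rot_class_eq; apply/andb_idl => h.
apply/subsetP => t; rewrite -rot_class_eq => /eqP e; apply: reflection_orbit_balanced.
by rewrite e mem_reflection -rot_class_eq e eq_sym rot_class_eq.
Qed.

(** * Double counting of the pairs (s, a) with [shift (reflection s) a = s] *)

(** The solutions [a] form a coset of the stabilizer of [s]. *)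
Lemma card_shift_eq (m : nat) (s t : signature m.+1) :
  t \in rot_class s -> (#|[set a | shift s a == t]| * #|rot_class s|)%N = m.+1.
Proof.
move=> /rot_classP[b ->].
have -> : [set a | shift s a == shift s b] = ('C[s | shift_action m] :* b)%g.
  rewrite -[X in (X :* _)%g]setTI -amove_act ?inE//.
  by apply/setP => a; rewrite !inE.
rewrite card_rcoset mulnC -['C[_ | _]%g]setTI card_orbit_stab.
by rewrite cardsT card_ord.
Qed.

Lemma sum_invariant (m : nat) :
  (\sum_(a < m.+1) #|[set s : signature m.+1 | shift (reflection s) a == s]| =
   #|invariant_classes m.+1| * m.+1)%N.
Proof.
pose F (s : signature m.+1) := #|[set a | shift (reflection s) a == s]|.
transitivity (\sum_(s in [set: signature m.+1]) F s)%N.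
  transitivity (\sum_(a < m.+1) \sum_(s : signature m.+1)
      (shift (reflection s) a == s))%N.
    by apply: eq_bigr => a _; rewrite -sum1dep_card big_mkcond.
  rewrite exchange_big; apply: eq_big => [s|s _]; first by rewrite inE.
  by rewrite /F -sum1dep_card [RHS]big_mkcond.
rewrite (partition_big_imset (@rot_class m)) -eq_classes_rotations /=.
rewrite -sum_nat_const.
rewrite [RHS](eq_bigl _ _ (fun C => in_set _ C)) big_mkcondr /=.
apply: eq_bigr => _ /[!eq_classes_rotations] /imsetP[u _ ->].
rewrite imset_reflection (eq_bigl (mem (rot_class u))) => [|s]; last first.
  by rewrite inE rot_class_eq.
have class_refl s : s \in rot_class u ->
    rot_class s = rot_class u /\
    rot_class (reflection s) = rot_class (reflection u).
  by rewrite -rot_class_eq -!imset_reflection => /eqP->.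
rewrite rot_class_eq; case: ifP => u_inv.
  rewrite -rot_class_eq in u_inv.
  have Fs s : s \in rot_class u -> (F s * #|rot_class u| = m.+1)%N.
    move=> /class_refl[su rsu]; rewrite -(eqP u_inv) -rsu card_shift_eq//.
    by rewrite -rot_class_eq rsu (eqP u_inv) su.
  have u_gt0 : (0 < #|rot_class u|)%N.
    by apply/card_gt0P; exists u; exact: orbit_refl.
  (* By [Fs], [F] is constant on the class, and the class size divides [m.+1], so the division is
     exact. *)
  rewrite (eq_bigr (fun=> m.+1 %/ #|rot_class u|)%N) => [|s /Fs e]; last first.
    by rewrite -[X in (X %/ _)%N]e mulnK.
  rewrite sum_nat_const mulnC divnK//; apply/dvdnP; exists (F u).
  by rewrite Fs//; exact: orbit_refl.
(* On a class that T moves, a single pair (s, a) would put [s] in the class of its reflection and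
   make the class invariant. *)
apply: big1 => s /class_refl[su rsu]; apply/eqP; rewrite cards_eq0 -subset0.
apply/subsetP => a; rewrite inE => /eqP sE.
have : s \in rot_class (reflection s) by apply/rot_classP; exists a.
by rewrite -mem_reflection -rot_class_eq su rsu rot_class_eq u_inv.
Qed.

Lemma card_fixed (m : nat) (a : 'I_m.+1) :
  #|[set s : signature m.+1 | shift (reflection s) a == s]| =
  if odd m.+1 || ~~ odd (ord_max - a)%R then 0%N else (2 ^ m.+1./2)%N.
Proof.
set c := (ord_max - a)%R.
have -> : [set s : signature m.+1 | shift (reflection s) a == s] =
    [set s : {ffun 'I_m.+1 -> bool} | [forall l, s (c - l)%R == ~~ s l]].
  apply/setP => s; rewrite !inE; apply/eqP/forallP => [/ffunP e l|e].
    by rewrite -(e l) !ffunE negbK rev_ordE opprD addrA addrAC.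
  apply/ffunP => l; apply: negb_inj; rewrite -(eqP (e l)) !ffunE negbK.
  by rewrite rev_ordE opprD addrA addrAC.
move: c => c; case: ifP => [c_fix|/norP[n_even]].
  suff [l lc] : exists l : 'I_m.+1, c - l = l.
    apply/eqP; rewrite cards_eq0 -subset0; apply/subsetP => s.
    by rewrite !inE => /forallP/(_ l); rewrite lc; case: (s l).
  (* A fixed point solves 2l = c modulo [m.+1]. [d] is an even representative of [c]: an odd [c]
     occurs here only with [m.+1] odd, and adding [m.+1] makes it even. Then [l] is half of [d]. *)
  have cm := ltn_ord c; pose d := (if odd c then c + m.+1 else c)%N.
  have d_even : ~~ odd d.
    rewrite /d; case: (boolP (odd c)) c_fix => // c_odd.
    by rewrite orbF oddD c_odd => ->.
  have dm : (d./2 < m.+1)%N by rewrite -divn2 /d; case: ifP; lia.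
  exists (inord d./2); apply/eqP; rewrite subr_eq; apply/eqP/val_inj => /=.
  rewrite inordK// addnn even_halfK// /d.
  by case: ifP => _; rewrite ?modnDr modn_small.
rewrite negbK => c_odd; rewrite card_anti_invariant ?card_ord// => l.
  by rewrite opprB addrC subrK.
(* A fixed point would make [c] the remainder of 2l modulo an even number, hence even. *)
apply/eqP => /eqP; rewrite subr_eq => /eqP /(congr1 val) /= e.
by move: c_odd; rewrite e odd_mod ?(negbTE n_even)// addnn odd_double.
Qed.

Lemma sum_odd (k x : nat) :
  (\sum_(0 <= i < k.*2) (if ~~ odd i then 0 else x) = k * x)%N.
Proof.
elim: k => [|k IH]; first by rewrite big_geq.
by rewrite doubleS !big_nat_recr//= IH odd_double addn0 mulSn addnC.
Qed.

Theorem theorem5 (n : nat) (n_gt0 : (0 < n)%N) :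
  (odd n -> (num_K n)%:R = (num_L n)%:R / 2 :> rat) /\
  (~~ odd n ->
     (num_K n)%:R = ((num_L n)%:R + (num_I n)%:R) / 2 :> rat /\
     (forall k : nat, n = (2 * k)%N -> num_I n = (2 ^ (k - 1))%N)).
Proof.
case: n n_gt0 => // m _.
have half (a b : nat) : (2 * a = b)%N -> a%:R = b%:R / 2 :> rat.
  by move=> <-; rewrite natrM mulrAC divff ?mul1r.
have KE := double_num_K m; split=> [n_odd|n_even]; last split=> [|[//|k] nk].
- apply: half; have := sum_invariant m.
  (* For odd length every term vanishes, so there is no invariant class. *)
  rewrite big1 => [/esym/eqP|a _]; last by rewrite card_fixed n_odd.
  by rewrite muln_eq0 orbF => /eqP I0; rewrite KE I0 addn0.
- by rewrite -natrD; apply: half; rewrite num_I_invariant.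
have := sum_invariant m; rewrite -num_I_invariant.
(* Substituting [ord_max - a] for [a] makes the reflection centre c itself the summation index. *)
rewrite (reindex_inj (subrI ord_max)) /=.
under eq_bigr do rewrite card_fixed (negbTE n_even) opprB addrC subrK.
rewrite -(big_mkord xpredT (fun c => if ~~ odd c then 0 else 2 ^ m.+1./2)%N) nk.
(* With length 2(k+1), the k+1 odd centres contribute 2^(k+1) each; dividing by the length leaves
   2^k. *)
rewrite mul2n doubleK sum_odd => e; apply/eqP.
by rewrite subn1 -(@eqn_pmul2r k.+1.*2)// -e -muln2 mulnCA -expnSr.
Qed.
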